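(* Let $I\subseteq P=\Bbbk[x_1,\dots,x_n]$ be a homogeneous ideal possessing a homogeneous Pommaret basis for some term order $\prec$, and let $D$ be the (Krull) dimension of the algebra $P/I$. Then $\{x_1,\dots,x_D\}$ is the unique maximal strongly independent set modulo the ideal $I$ (for $\prec$).
   Context: $\Bbbk$ is a field. $\mathrm{lt}_\prec I$ is the ideal generated by the leading terms of the non-zero elements of $I$, $\mathrm{le}_\prec f$ the leading exponent of $f\neq0$. A subset $X\subseteq\{x_1,\dots,x_n\}$ is strongly independent modulo $I$ for $\prec$ if $\mathrm{lt}_\prec I\cap\Bbbk[X]=\{0\}$; maximality is with respect to inclusion. The class of $\mu\in\mathbb{N}_0^n$ is $\mathrm{cls}\,\mu=\min\{j\mid\mu_j\ne0\}$, with $\mathrm{cls}\,0=n$; the Pommaret cone of $\mu$ is $C_P(\mu)=\{\mu+\rho\mid\rho\in\mathbb{N}_0^n,\ \rho_j=0\text{ for all }j>\mathrm{cls}\,\mu\}$. A Pommaret basis of $I$ for $\prec$ is a finite set $H\subset I\setminus\{0\}$ with pairwise distinct leading exponents such that $\mathrm{le}_\prec I=\{\mathrm{le}_\prec f\mid0\ne f\in I\}$ is the disjoint union of the cones $C_P(\mathrm{le}_\prec h)$, $h\in H$; it is homogeneous if all its elements are. *)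

(* Defs.v *)
From HB Require Import structures.
From mathcomp Require Import all_boot all_order all_algebra.
From mathcomp Require Import mpoly.

Set Implicit Arguments.
Unset Strict Implicit.
Unset Printing Implicit Defensive.

Import GRing.Theory.
Local Open Scope ring_scope.

(* Variables and exponents are indexed by 'I_n = {0, ..., n-1}: the variable
   x_j of the mathematical text is 'X_i with j = i.+1. *)

Definition term_order (n : nat) (le : rel 'X_{1..n}) : Prop :=
  [/\ total le, antisymmetric le, transitive le,
      forall m, le 0%MM m
    & forall m1 m2 m, le m1 m2 -> le (m1 + m)%MM (m2 + m)%MM].

(* The greatest exponent of the support; the default 0%MM is harmless, being
   the least exponent of a term order, and is only returned as such for p = 0. *)
Definition lexp (n : nat) (k : fieldType) (le : rel 'X_{1..n})
    (p : {mpoly k[n]}) : 'X_{1..n} :=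
  foldr (fun m1 m2 => if le m1 m2 then m2 else m1) 0%MM (msupp p).

Definition ideal_gen (R : comNzRingType) (S : R -> Prop) (f : R) : Prop :=
  exists2 s : seq (R * R),
    forall u, u \in s -> S u.2 & f = \sum_(u <- s) u.1 * u.2.

Definition homogeneous (n : nat) (k : fieldType) (p : {mpoly k[n]}) : Prop :=
  exists d : nat, p \is d.-homog.

Definition homog_ideal (n : nat) (k : fieldType)
    (I : idealr {mpoly k[n]}) : Prop :=
  exists2 S : {mpoly k[n]} -> Prop,
    forall p, S p -> homogeneous p &
    forall f, f \in I <-> ideal_gen S f.

Definition lt_ideal (n : nat) (k : fieldType) (le : rel 'X_{1..n})
    (I : idealr {mpoly k[n]}) : {mpoly k[n]} -> Prop :=
  ideal_gen (fun t => exists f, [/\ f \in I, f != 0 & t = 'X_[lexp le f]]).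

Definition in_subring (n : nat) (k : fieldType) (X : {set 'I_n})
    (f : {mpoly k[n]}) : Prop :=
  forall m, m \in msupp f -> forall i, i \notin X -> m i = 0%N.

Definition strongly_independent (n : nat) (k : fieldType)
    (le : rel 'X_{1..n}) (I : idealr {mpoly k[n]}) (X : {set 'I_n}) : Prop :=
  forall f, lt_ideal le I f /\ in_subring X f <-> f = 0.

Definition max_strongly_independent (n : nat) (k : fieldType)
    (le : rel 'X_{1..n}) (I : idealr {mpoly k[n]}) (X : {set 'I_n}) : Prop :=
  strongly_independent le I X /\
  forall Y : {set 'I_n},
    X \subset Y -> strongly_independent le I Y -> Y = X.

(* The class with its usual 1-based value; the default n gives cls 0 = n. *)
Definition cls (n : nat) (m : 'X_{1..n}) : nat :=
  (\big[minn/n]_(i < n | m i != 0) i.+1)%N.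

Definition pommaret_cone (n : nat) (m : 'X_{1..n}) (m' : 'X_{1..n}) : Prop :=
  exists2 r : 'X_{1..n},
    m' = (m + r)%MM & forall i : 'I_n, (cls m < i.+1)%N -> r i = 0%N.

Definition pommaret_basis (n : nat) (k : fieldType) (le : rel 'X_{1..n})
    (I : idealr {mpoly k[n]}) (H : seq {mpoly k[n]}) : Prop :=
  [/\ forall h, h \in H -> h \in I /\ h != 0,
      {in H &, injective (lexp le)},
      forall m, (exists f, [/\ f \in I, f != 0 & lexp le f = m]) <->
                (exists2 h, h \in H & pommaret_cone (lexp le h) m)
    & forall h1 h2, h1 \in H -> h2 \in H -> h1 != h2 ->
      forall m, ~ (pommaret_cone (lexp le h1) m /\
                   pommaret_cone (lexp le h2) m)].

(* c 0 < c 1 < ... < c l is a strict chain of prime ideals, of length l; the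
   ideals c i with i > l are irrelevant. *)
Definition prime_chain (R : comNzRingType) (c : nat -> prime_idealr R)
    (l : nat) : Prop :=
  forall i, (i < l)%N ->
    {subset c i <= c i.+1} /\ ~ {subset c i.+1 <= c i}.

Definition krull_dim (R : comNzRingType) (d : nat) : Prop :=
  (exists c : nat -> prime_idealr R, prime_chain c d) /\
  (forall (c : nat -> prime_idealr R) (l : nat), prime_chain c l -> (l <= d)%N).

(* Main.v *)
Require Import Defs.
From HB Require Import structures.
From mathcomp Require Import all_boot all_order all_algebra.
From mathcomp Require Import mpoly.
From mathcomp Require boolp classical_sets.

Set Implicit Arguments.
Unset Strict Implicit.
Unset Printing Implicit Defensive.

Import GRing.Theory.
Import Order.TTheory.
Local Open Scope ring_scope.

(* Because the basis is finite, a monomial of lt I in x_1, ..., x_j forces a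
   pure power of x_j into lt I.  Hence there is a threshold d such that lt I
   contains a pure power of every x_j with j > d and no monomial in
   x_1, ..., x_d, so that {x_1, ..., x_d} is the unique maximal strongly
   independent set, and it remains to see that d is the Krull dimension of P/I.

   Reduction by the homogeneous basis elements with leading terms x_j^a shows
   that the polynomials of degree < e span a space of dimension O(e^d) modulo I.
   A chain of l+1 primes yields l elements that are algebraically independent
   modulo I, and counting their monomials gives l <= d.

   Conversely, by the Coquand-Lombardi criterion a chain of d+1 primes exists
   unless some product x_1^m_1(x_2^m_2( ... (1 + x_d r_d) ... ) + x_1 r_1) lies
   in I.  Its homogeneous component of degree |m| would rewrite x^m into
   monomials whose exponents of x_1, ..., x_d are lexicographically higher, and
   the dimension above would drop to O(e^(d-1)), which is too small for the
   monomials in x_1, ..., x_d, independent modulo I. *)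

(** * Chains of prime ideals *)

Definition is_ideal (R : comNzRingType) (J : R -> Prop) : Prop :=
  [/\ J 0, forall x y, J x -> J y -> J (x + y)
    & forall a x, J x -> J (a * x)].

(** Ideals are built below as [Prop] predicates, while [prime_idealr] rests on a Boolean one;
    [asbool] decides membership classically. *)
Lemma prime_idealr_of_pred (R : comNzRingType) (J : R -> Prop) :
    is_ideal J -> ~ J 1 -> (forall x y, J (x * y) -> J x \/ J y) ->
  exists p : prime_idealr R, forall x, x \in p <-> J x.
Proof.
case=> J0 JD JM J1 JP; pose p : pred R := fun x => boolp.asbool (J x).
have pP x : reflect (J x) (x \in p) by apply: boolp.asboolP.
have p_ideal : idealr_closed p.
  split; [exact/pP | exact/pP | move=> a x y /pP Jx /pP Jy].
  by apply/pP/JD => //; apply: JM.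
have p_prime : prime_idealr_closed p.
  by move=> x y /pP/JP[] /pP ->; rewrite ?orbT.
pose q : prime_idealr R := HB.pack (p : R -> bool)
  (isIdealr.Build R p p_ideal) (isPrimeIdealrClosed.Build R p p_prime).
by exists q => x; split=> /pP.
Qed.

(** Krull's argument: an ideal maximal among those that contain [J] and miss the multiplicative set
    [S] is prime. *)
Lemma prime_avoiding (R : comNzRingType) (J S : R -> Prop) :
    is_ideal J -> S 1 -> (forall x y, S x -> S y -> S (x * y)) ->
    (forall x, J x -> ~ S x) ->
  exists p : prime_idealr R,
    (forall x, J x -> x \in p) /\ (forall x, x \in p -> ~ S x).
Proof.
move=> [J0 JD JM] S1 SM JS.
(* Zorn's lemma runs over the sets whose union with [J] is an ideal missing [S]; in this form the
   union of the empty chain qualifies too. *)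
pose ext (X : R -> Prop) x := X x \/ J x.
pose P (X : R -> Prop) := is_ideal (ext X) /\ forall x, ext X x -> ~ S x.
have [F FP Ftot|A [[[A0 AD AM] AS] Amax]] := @classical_sets.Zorn_bigcup R P.
  split; last first.
    move=> x [[X FX Xx]|Jx]; last exact: JS.
    by have [_ ] := FP X FX; apply; left.
  have extU X x : F X -> ext X x -> ext (classical_sets.bigcup F id) x.
    by move=> FX [Xx|]; [left; exists X | right].
  have extF x : ext (classical_sets.bigcup F id) x ->
      J x \/ exists2 X, F X & ext X x.
    by case=> [[X FX Xx]|]; [right; exists X; rewrite /ext; auto | left].
  split; first by right.
    move=> x y /extF[Jx|[X FX Xx]] /extF[Jy|[Y FY Yy]].
    - by right; apply: JD.
    - have [[_ YD _] _] := FP Y FY.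
      by apply: (extU Y) => //; apply: YD => //; right.
    - have [[_ XD _] _] := FP X FX.
      by apply: (extU X) => //; apply: XD => //; right.
    - have [[_ XD _] _] := FP X FX; have [[_ YD _] _] := FP Y FY.
      have [XY|YX] := Ftot X Y FX FY.
        apply: (extU Y) => //; apply: YD => //.
        by case: Xx => [/XY|]; [left | right].
      apply: (extU X) => //; apply: XD => //.
      by case: Yy => [/YX|]; [left | right].
  move=> a x /extF[Jx|[X FX Xx]]; first by right; apply: JM.
  by have [[_ _ XM] _] := FP X FX; apply: (extU X) => //; apply: XM.
(* By maximality, adjoining an outside element [x] to the ideal [ext A] yields an ideal that meets
   [S]. *)
have meetS x : ~ ext A x -> exists s m a, [/\ S s, ext A m & s = m + a * x].
  move=> Ax; apply: boolp.contrapT => noS.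
  pose B y := exists m a, ext A m /\ y = m + a * x.
  have AB y : ext A y -> B y by exists y, 0; rewrite mul0r addr0.
  have extB y : ext B y -> B y by case=> // Jy; apply: AB; right.
  apply: (Amax B); last first.
    split; last first.
      by move=> y /extB[m [a [Am ->]]] Sy; apply: noS; exists (m + a * x), m, a.
    split; first by left; apply: AB.
      move=> _ _ /extB[m [a [Am ->]]] /extB[m' [a' [Am' ->]]].
      left; exists (m + m'), (a + a'); split; first exact: AD.
      by rewrite mulrDl addrACA.
    move=> b _ /extB[m [a [Am ->]]]; left; exists (b * m), (b * a).
    by split; [apply: AM | rewrite mulrDr mulrA].
  split; last first.
    move=> BA; apply: Ax; left; apply: BA; exists 0, 1.
    by rewrite mul1r add0r.
  by move=> y Ay; apply: AB; left.
have [|||p pP] := @prime_idealr_of_pred R (ext A).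
- by split.
- by move=> A1; apply: (AS _ A1).
- move=> x y Axy; apply: boolp.contrapT => /boolp.not_orP[].
  move=> /meetS[s [m [a [Ss Am es]]]] /meetS[s' [m' [a' [Ss' Am' es']]]].
  apply: (AS (s * s')); last exact: SM.
  rewrite {1}es mulrDl; apply: (AD); first by rewrite mulrC; apply: AM.
  rewrite es' mulrDr; apply: AD; first by apply: AM.
  by rewrite mulrACA; apply: AM.
- exists p; split=> x; first by move=> Jx; apply/pP; right.
  by move/pP/AS.
Qed.

(* Lombardi's iterated boundary monoid: it misses 0 as soon as (and only if)
   there is a chain of primes p_0 < ... < p_l with y_i in p_i but not in
   p_(i-1). *)
Fixpoint bmonoid (R : comNzRingType) (ys : seq R) (f : R) : Prop :=
  if ys is y :: ys' then
    exists m r t, bmonoid ys' t /\ f = y ^+ m * (t + y * r)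
  else f = 1.

Lemma bmonoid1 (R : comNzRingType) (ys : seq R) : bmonoid ys 1.
Proof.
elim: ys => //= y ys IH; exists 0, 0, 1.
by rewrite mulr0 addr0 expr0 mul1r.
Qed.

Lemma bmonoidM (R : comNzRingType) (ys : seq R) f g :
  bmonoid ys f -> bmonoid ys g -> bmonoid ys (f * g).
Proof.
elim: ys f g => [|y ys IH] f g /=; first by move=> -> ->; rewrite mulr1.
move=> [m [r [t [Tt ->]]]] [m' [r' [t' [Tt' ->]]]].
exists (m + m')%N, (r * t' + t * r' + y * r * r'), (t * t').
split; first exact: IH.
rewrite exprD mulrACA; congr (_ * _).
rewrite mulrDl !mulrDr -!addrA; congr (_ + _).
rewrite addrCA mulrA; congr (_ + _).
  by rewrite mulrCA mulrA.
by rewrite -!mulrA; congr (_ + _); rewrite ?(mulrCA r y).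
Qed.

(** The first prime [p] contains [J] and misses the monoid of [y :: ys], to which [y] belongs. Then
    p + (y) misses the monoid of [ys], as [u + y * a] in the latter would put [u] in the former; the
    induction continues with this ideal. *)
Lemma prime_chain_of_bmonoid (R : comNzRingType) (ys : seq R) (J : R -> Prop) :
    is_ideal J -> (forall x, J x -> ~ bmonoid ys x) ->
  exists c : nat -> prime_idealr R,
    prime_chain c (size ys) /\ forall x, J x -> x \in c 0%N.
Proof.
elim: ys J => [|y ys IH] J Jid JS.
  have [p [Jp _]] := prime_avoiding Jid (bmonoid1 _) (@bmonoidM _ _) JS.
  by exists (fun=> p).
have [p [Jp pS]] := prime_avoiding Jid (bmonoid1 _) (@bmonoidM _ _) JS.
have yp : y \notin p.
  apply/negP => /pS; apply; exists 1%N, 0, 1.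
  by rewrite mulr0 addr0 mulr1 expr1; split=> //; apply: bmonoid1.
pose J' x := exists u a, u \in p /\ x = u + y * a.
have [||c [cc J'c]] := IH J'.
- split; first by exists 0, 0; rewrite mulr0 addr0 idealr0.
    move=> _ _ [u [a [pu ->]]] [u' [a' [pu' ->]]].
    by exists (u + u'), (a + a'); rewrite rpredD // mulrDr addrACA.
  move=> b _ [u [a [pu ->]]]; exists (b * u), (b * a).
  by rewrite idealMr // mulrDr mulrCA.
- move=> _ [u [a [pu ->]]] Su; apply: (pS _ pu).
  exists 0%N, (- a), (u + y * a); split=> //.
  by rewrite expr0 mul1r mulrN addrK.
have pc : {subset p <= c 0%N}.
  by move=> x px; apply: J'c; exists x, 0; rewrite mulr0 addr0.
exists (fun i => if i is i'.+1 then c i' else p); split=> // -[|i] lti.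
  split=> // /(_ y); rewrite (negPf yp) => cp.
  by apply/notF/cp/J'c; exists 0, 1; rewrite add0r mulr1 idealr0.
exact: cc.
Qed.

(** * Lexicographic order and independence of monomials along a chain of primes *)

Definition lexlt (s t : seq nat) : bool :=
  ((s : seqlexi nat) < (t : seqlexi nat))%O.

Lemma lexlt_cons m n s t :
  lexlt (m :: s) (n :: t) = (m < n)%N || (m == n) && lexlt s t.
Proof.
rewrite /lexlt ltxi_cons !leEnat; case: ltngtP => //= _.
Qed.

Lemma finType_wf_ind (T : finType) (r : rel T) (P : T -> Prop) :
    irreflexive r -> transitive r ->
  (forall x, (forall y, r y x -> P y) -> P x) -> forall x, P x.
Proof.
move=> r_irr r_tr IH x.
have [N] := ubnP #|[pred y | r y x]|; elim: N x => // N IHN x ltN.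
apply: IH => y ryx; apply: IHN; rewrite -ltnS.
apply: leq_trans ltN; rewrite ltnS; apply: proper_card; apply/properP; split.
  by apply/subsetP => z; rewrite !inE => /r_tr; apply.
by exists y; rewrite !inE // r_irr.
Qed.

Fixpoint monom (R : comNzRingType) (ys : seq R) (u : seq nat) : R :=
  match ys, u with
  | y :: ys', m :: u' => y ^+ m * monom ys' u'
  | _, _ => 1
  end.

(* The ideal generated by the products y_1^u_1 ... y_i^(u_i + 1), so that
   bmonoid ys is the union of the cosets monom ys u + lexhigher ys u. *)
Fixpoint lexhigher (R : comNzRingType) (ys : seq R) (u : seq nat) (g : R) :=
  match ys, u with
  | y :: ys', m :: u' =>
    exists r g', lexhigher ys' u' g' /\ g = y ^+ m * (g' + y * r)
  | _, _ => g = 0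
  end.

Section LexHigher.
Variable R : comNzRingType.
Implicit Types (ys : seq R) (u v : seq nat).

Lemma lexhigher0 ys u : lexhigher ys u 0.
Proof.
elim: ys u => [|y ys IH] [|m u] //=; exists 0, 0; split=> //.
by rewrite mulr0 addr0 mulr0.
Qed.

Lemma lexhigherD ys u g h :
  lexhigher ys u g -> lexhigher ys u h -> lexhigher ys u (g + h).
Proof.
elim: ys u g h => [|y ys IH] [|m u] g h /=;
  do ?by move=> -> ->; rewrite addr0.
move=> [r [g' [Gg ->]]] [s [h' [Gh ->]]]; exists (r + s), (g' + h').
by split; [apply: IH | rewrite -mulrDr [y * (r + s)]mulrDr addrACA].
Qed.

Lemma lexhigherM ys u a g : lexhigher ys u g -> lexhigher ys u (a * g).
Proof.
elim: ys u g => [|y ys IH] [|m u] g /=; do ?by move=> ->; rewrite mulr0.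
move=> [r [g' [Gg ->]]]; exists (a * r), (a * g').
by split; [apply: IH | rewrite mulrCA mulrDr (mulrCA a)].
Qed.

Lemma lexhigher_monom ys u v :
    size u = size ys -> size v = size ys -> lexlt u v ->
  lexhigher ys u (monom ys v).
Proof.
elim: ys u v => [|y ys IH] [|m u] [|n v] //= [szu] [szv].
rewrite lexlt_cons => /orP[lt_mn|/andP[/eqP <- /IH]]; last first.
  move/(_ szu szv) => G; exists 0, (monom ys v).
  by rewrite mulr0 addr0.
exists (y ^+ (n - m).-1 * monom ys v), 0; split; first exact: lexhigher0.
rewrite add0r !mulrA -exprSr -exprD; congr (y ^+ _ * _).
by rewrite addSnnS prednK ?subn_gt0 // subnKC // ltnW.
Qed.

(** Modulo the prime [c 0] the power of [y] can be cancelled; modulo [c 1], which contains [c 0],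
    the summand [y * r] disappears, and induction applies to the shifted chain. *)
Lemma prime_chain_lexhigher (c : nat -> prime_idealr R) ys u g :
    prime_chain c (size ys) -> size u = size ys ->
    (forall i, (i < size ys)%N -> ys`_i \in c i.+1 /\ ys`_i \notin c i) ->
    lexhigher ys u g ->
  monom ys u + g \notin c 0%N.
Proof.
elim: ys c u g => [|y ys IH] c [|m u] g //= cc szu ysc.
  by move=> ->; rewrite addr0 idealr1.
move=> [r [g' [Gg ->]]]; rewrite -mulrDr.
have [yc1 yc0] := ysc 0%N isT; apply/negP; rewrite prime_idealrM => /orP[].
  by elim: (m) => [|j IHj]; rewrite ?expr0 ?idealr1 // exprS prime_idealrM
     (negPf yc0).
have [c01 _] := cc 0%N isT; move/c01; rewrite addrA.
rewrite rpredDr ?[y * r]mulrC ?idealMr //; apply/negP.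
apply: (IH (fun i => c i.+1)) Gg => [i|| i].
- exact: (cc i.+1).
- by case: szu.
- exact: (ysc i.+1).
Qed.

(* Lexicographic order: the least monomial with a nonzero coefficient cannot
   be compensated by the others. *)
Lemma prime_chain_indep (k : fieldType) (phi : {rmorphism k -> R})
    (c : nat -> prime_idealr R) ys (T : finType) (key : T -> seq nat)
    (b : T -> k) :
    prime_chain c (size ys) ->
    (forall i, (i < size ys)%N -> ys`_i \in c i.+1 /\ ys`_i \notin c i) ->
    injective key -> (forall t, size (key t) = size ys) ->
    \sum_t phi (b t) * monom ys (key t) \in c 0%N ->
  forall t, b t = 0.
Proof.
move=> cc ysc key_inj szk sum0.
apply: (@finType_wf_ind T (fun x y => lexlt (key x) (key y))).
- by move=> x; apply: ltxx.
- by move=> y x z; apply: lt_trans.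
move=> x IH; apply/eqP/negP => /negP nz.
move: (idealMr (phi (b x)^-1) sum0); apply/negP.
rewrite (bigD1 x) //= mulrDr mulrA -rmorphM mulVf // rmorph1 mul1r.
apply: prime_chain_lexhigher => //; apply: lexhigherM.
elim/big_ind: _ => [|g h|t tx]; [exact: lexhigher0 | exact: lexhigherD |].
have: key t != key x by apply: contraNneq tx => /key_inj ->.
move/eqP; case: (ltgtP (key t : seqlexi nat) (key x)) => // ltt _.
  by rewrite IH // rmorph0 mul0r; apply: lexhigher0.
by apply/lexhigherM/lexhigher_monom.
Qed.
End LexHigher.

(** * Normal forms modulo an ideal *)

Section NormalForms.
Variables (k : fieldType) (n : nat) (I : idealr {mpoly k[n]}).
Implicit Types (p q g : {mpoly k[n]}) (w m : 'X_{1..n}).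

(** With more elements than exponents in [V], the coefficient matrix of the remainders [g t] has a
    non-zero left kernel vector, which is a linear relation modulo [I]. *)
Lemma leq_card_spanned (V : seq 'X_{1..n}) (T : finType)
    (q : T -> {mpoly k[n]}) :
    (forall t, exists2 g, q t - g \in I & {subset msupp g <= V}) ->
    (forall b : T -> k, \sum_t b t *: q t \in I -> forall t, b t = 0) ->
  (#|T| <= size V)%N.
Proof.
move=> /fin_all_exists2[g qgI gV] free; rewrite leqNgt; apply/negP => ltVT.
pose M := \matrix_(i < #|T|, j < size V) (g (enum_val i))@_(nth 0%MM V j).
have : kermx M != 0.
  rewrite kermx_eq0 /row_free neq_ltn (leq_ltn_trans _ ltVT) //.
  exact: rank_leq_col.
case/rowV0Pn => v /sub_kermxP vM; apply/negP/negPn/eqP/rowP => i.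
rewrite mxE -(enum_valK i); apply: (free (fun t => v 0 (enum_rank t))).
(* The same combination of the [g t] vanishes, so only differences in [I] remain. *)
have -> : \sum_t v 0 (enum_rank t) *: q t =
    \sum_t v 0 (enum_rank t) *: (q t - g t).
  apply/eqP; rewrite -subr_eq0 -sumrB; apply/eqP/mpolyP => m.
  rewrite mcoeff0 raddf_sum /=.
  under eq_bigr do rewrite scalerBr subKr mcoeffZ.
  have [mV|mV] := boolP (m \in V); last first.
    apply: big1 => t _; rewrite memN_msupp_eq0 ?mulr0 //.
    by apply: contra mV; apply: gV.
  have ltmV : (index m V < size V)%N by rewrite index_mem.
  move/rowP/(_ (Ordinal ltmV)): vM; rewrite !mxE => vM0.
  rewrite -[RHS]vM0 (reindex (@enum_val T T)) /=; last first.
    by apply: onW_bij; apply: enum_val_bij.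
  by apply: eq_bigr => j _; rewrite enum_valK mxE /= nth_index.
apply: rpred_sum => t _; rewrite -mul_mpolyC; exact: idealMr.
Qed.

Lemma mnm_box_cover (b : 'I_n -> nat) :
  exists2 V : seq 'X_{1..n}, size V = (\prod_i b i)%N &
    forall w, (forall i, (w i < b i)%N) -> w \in V.
Proof.
exists [seq [multinom (f i : nat) | i < n] |
          f : {dffun forall i : 'I_n, 'I_(b i)}].
  rewrite size_map -cardE card_dep_ffun foldrE big_map big_enum /=.
  by apply: eq_bigr => i _; rewrite card_ord.
move=> w wb; apply/mapP; exists [ffun i => Ordinal (wb i)].
  by rewrite mem_enum.
by apply/mnmP => i; rewrite mnmE ffunE.
Qed.

Lemma reduce_msupp (N : 'X_{1..n} -> Prop) q :
    (forall w, w \in msupp q -> exists2 g, 'X_[w] - g \in I &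
       forall w', w' \in msupp g -> N w') ->
  exists2 g, q - g \in I & forall w', w' \in msupp g -> N w'.
Proof.
move=> Nq; rewrite [q]mpolyE big_seq; elim/big_ind: _.
- by exists 0; [rewrite subr0 idealr0 | move=> w; rewrite msupp0].
- move=> p1 p2 [g1 I1 N1] [g2 I2 N2]; exists (g1 + g2).
    by rewrite opprD addrACA rpredD.
  by move=> w /msuppD_le; rewrite mem_cat => /orP[/N1|/N2].
move=> w /Nq[g Ig Ng]; exists (q@_w *: g).
  by rewrite -scalerBr -mul_mpolyC idealMr.
by move=> w' /msuppZ_le /Ng.
Qed.

(** [r] may have infinite descending chains, but rewriting never raises the degree: it stays among
    the finitely many exponents of degree below [msize q], where it terminates. *)
Lemma reduce_normal (N : pred 'X_{1..n}) (r : rel 'X_{1..n}) q :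
    irreflexive r -> transitive r ->
    (forall w, ~~ N w -> exists2 g, 'X_[w] - g \in I &
       forall w', w' \in msupp g -> r w' w /\ (mdeg w' <= mdeg w)%N) ->
  exists2 g, q - g \in I &
    forall w, w \in msupp g -> N w /\ (mdeg w < msize q)%N.
Proof.
move=> r_irr r_tr red; apply: reduce_msupp => w0 /msize_mdeg_lt.
set e := mmeasure _ _ => lt_w0.
pose r' (x y : 'X_{1..n < e}) := r x y.
apply: (@finType_wf_ind _ r' (fun x => exists2 g, 'X_[x] - g \in I &
  forall w', w' \in msupp g -> N w' /\ (mdeg w' < e)%N) _ _ _ 
  (BMultinom lt_w0)) => [x|y x z|x IH]; [exact: r_irr | exact: r_tr |].
have [Nx|/red[g Ig gx]] := boolP (N x).
  exists 'X_[x]; first by rewrite subrr idealr0.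
  by move=> w' /mem_msuppXP <-; split=> //; apply: bmdeg.
have [|g' Ig' Ng'] := @reduce_msupp (fun w => N w /\ (mdeg w < e)%N) g.
  move=> w /gx[rwx le_wx].
  have lt_we : (mdeg w < e)%N by apply: leq_ltn_trans le_wx (bmdeg x).
  exact: (IH (BMultinom lt_we)).
by exists g' => //; rewrite -(subrKA g) rpredD.
Qed.

End NormalForms.

(** * Leading exponents and Pommaret bases *)

Section LeadingExponents.
Variables (k : fieldType) (n : nat) (le : rel 'X_{1..n}).
Hypothesis le_order : term_order le.
Implicit Types (p f h : {mpoly k[n]}) (m v w : 'X_{1..n}).

Lemma msupp_lexp_max p m : m \in msupp p -> le m (lexp le p).
Proof.
have [le_tot le_anti le_tr _ _] := le_order; rewrite /lexp.
elim: (msupp p) => //= v s IH; rewrite inE; set M := foldr _ _ _ in IH *.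
have le_refl w : le w w by case/orP: (le_tot w w).
case/predU1P => [->|/IH le_mM]; case: ifP => // /negbT le_vM.
by apply: le_tr le_mM _; case/orP: (le_tot M v) le_vM => // ->.
Qed.

Lemma lexp_msupp p : p != 0 -> lexp le p \in msupp p.
Proof.
have [_ le_anti _ le0 _] := le_order; rewrite -msupp_eq0 /lexp.
case: (msupp p) => // v s _; elim: s v => [|w s IH] v.
  (* If the fold keeps the default [0%MM], then [le v 0%MM] makes [v] equal to it, so the value
     still lies in the support. *)
  rewrite /= inE; case: ifP (le0 v) => //= le_v0 le_0v.
  by rewrite [v](le_anti _ 0%MM) ?eqxx ?le_v0 ?le_0v.
move: (IH w); rewrite /= -/(foldr _ _ _) => IHw.
by case: ifP => _; rewrite inE ?eqxx // IHw orbT.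
Qed.

Lemma lexp_eq p m :
  m \in msupp p -> (forall v, v \in msupp p -> le v m) -> lexp le p = m.
Proof.
have [_ le_anti _ _ _] := le_order => pm max_m; apply: le_anti.
rewrite msupp_lexp_max // max_m // lexp_msupp //.
by apply: contraTneq pm => ->; rewrite msupp0.
Qed.

Variable I : idealr {mpoly k[n]}.

Definition lexp_ideal m : Prop :=
  exists f, [/\ f \in I, f != 0 & lexp le f = m].

Lemma lexp_idealD m v : lexp_ideal m -> lexp_ideal (m + v).
Proof.
have [_ _ _ _ leD] := le_order.
case=> f [If nz_f <-]; exists (f * 'X_[v]).
have supp_f w : (w \in msupp (f * 'X_[v])) =
    (w \in [seq (v + w')%MM | w' <- msupp f]).
  exact: perm_mem (msuppMX f v) w.
have fv : (lexp le f + v)%MM \in msupp (f * 'X_[v]).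
  by rewrite supp_f addmC map_f // lexp_msupp.
split; first by rewrite mulrC idealMr.
  by apply: contraTneq fv => ->; rewrite msupp0.
apply: lexp_eq fv _ => w; rewrite supp_f => /mapP[w' fw' ->].
by rewrite addmC; apply/leD/msupp_lexp_max.
Qed.

(** A polynomial with leading exponent 0 is a non-zero constant, and an [idealr] is proper. *)
Lemma lexp_ideal0 : ~ lexp_ideal 0%MM.
Proof.
have [_ le_anti _ le0 _] := le_order.
case=> f [If nz_f f0]; have fC : f = (f@_0%MM)%:MP.
  apply/mpolyP => m; rewrite mcoeffC; have [->|nz_m] := eqVneq m 0%MM.
    by rewrite mulr1.
  rewrite mulr0; apply: memN_msupp_eq0; apply: contra nz_m => /msupp_lexp_max.
  by rewrite f0 => le_m0; apply/eqP/le_anti; rewrite le_m0 le0.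
have nz_f0 : f@_0%MM != 0.
  by apply: contraNneq nz_f => f00; rewrite fC f00 mpolyC0.
have := idealMr (f@_0%MM)^-1%:MP If.
by rewrite {2}fC -mpolyCM mulVf // mpolyC1 idealr1.
Qed.

Lemma lt_ideal_msupp f m : lt_ideal le I f -> m \in msupp f -> lexp_ideal m.
Proof.
case=> s sS ->; rewrite big_seq => fm; move: m fm.
elim/big_ind: _ => [m|p q IHp IHq m|u us m].
- by rewrite msupp0.
- by move/msuppD_le; rewrite mem_cat => /orP[/IHp|/IHq].
have [g [Ig nz_g ->]] := sS u us.
rewrite (perm_mem (msuppMX _ _)) => /mapP[w _ ->].
by apply: lexp_idealD; exists g.
Qed.

(** [lt_ideal] is a monomial ideal, so testing monomials suffices. *)
Lemma strongly_independentP (X : {set 'I_n}) :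
  strongly_independent le I X <->
  forall m, lexp_ideal m -> exists2 i, i \notin X & m i != 0%N.
Proof.
split=> [indep m [g [Ig nz_g gm]]|indep f].
  apply: boolp.contrapT => mX.
  suff : 'X_[m] = 0 :> {mpoly k[n]} by apply/eqP; rewrite -msupp_eq0 msuppX.
  apply/indep; split.
    exists [:: (1, 'X_[m])]; last by rewrite big_seq1 mul1r.
    by move=> u; rewrite inE => /eqP -> /=; exists g; rewrite gm.
  move=> w /mem_msuppXP <- i iX; apply/eqP/negPn/negP => nz_mi.
  by apply: mX; exists i.
split=> [[If Xf]|->]; last first.
  split; first by exists [::]; rewrite ?big_nil.
  by move=> m; rewrite msupp0.
apply/eqP/negPn/negP => /lexp_msupp fm.
have [i iX] := indep _ (lt_ideal_msupp If fm).
by rewrite (Xf _ fm).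
Qed.

Lemma ideal_in_subring (X : {set 'I_n}) f :
    (forall m, lexp_ideal m -> exists2 i, i \notin X & m i != 0%N) ->
  f \in I -> in_subring X f -> f = 0.
Proof.
move=> indep If Xf; apply/eqP/negPn/negP => nz_f.
have [|i iX] := indep (lexp le f); first by exists f.
by rewrite (Xf _ (lexp_msupp nz_f)).
Qed.

Lemma cls_le m i : m i != 0%N -> (cls m <= i.+1)%N.
Proof.
move=> nz_mi; rewrite /cls; have : i \in index_enum 'I_n.
  by rewrite mem_index_enum.
elim: (index_enum _) => // j s IH; rewrite inE big_cons.
case/predU1P => [<-|/IH le_i]; first by rewrite nz_mi geq_minl.
by case: ifP => // _; rewrite geq_min le_i orbT.
Qed.

(* A monomial of lt I in x_0, ..., x_j stays in lt I when multiplied by large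
   powers of x_j, so one of the finitely many cones contains x_j as a
   multiplicative direction of its vertex. *)
Lemma pommaret_pure_power (H : seq {mpoly k[n]}) m (j : 'I_n) :
    pommaret_basis le I H -> lexp_ideal m ->
    (forall i : 'I_n, (j < i)%N -> m i = 0%N) ->
  exists2 h, h \in H & exists a, lexp le h = (U_(j) *+ a)%MM.
Proof.
case=> _ _ leH _ Im mj.
(* [s] exceeds the [j]-th entry of every leading exponent of the basis, so whichever cone contains
   the shifted exponent, its cofactor [r] has a non-zero [j]-th entry. *)
pose s := (\max_(h <- H) lexp le h j).+1.
have /leH[h Hh [r er clsr]] := lexp_idealD (U_(j) *+ s) Im.
exists h => //; exists (lexp le h j).
have lt_hs : (lexp le h j < s)%N.
  rewrite ltnS.
  by apply: (@leq_bigmax_seq _ H xpredT (fun h => lexp le h j) h Hh isT).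
have eqE i : (m i + (j == i) * s = lexp le h i + r i)%N.
  by move/mnmP/(_ i): er; rewrite !mnmDE mulmnE mnm1E.
have nz_rj : r j != 0%N.
  move: (eqE j); rewrite eqxx mul1n; case: (r j) => // e.
  by move: lt_hs; rewrite -[lexp le h j]addn0 -e ltnNge leq_addl.
(* Thus [j] is within the class: the entries of [lexp le h] before [j] vanish by the definition of
   [cls], those after [j] because [m] has none there. *)
have clsj : (j < cls (lexp le h))%N.
  by rewrite ltnNge; apply: contra nz_rj => lt_clsj; apply/eqP/clsr.
apply/mnmP => i; rewrite mulmnE mnm1E.
case: (ltngtP i j) => [lt_ij|lt_ji|/val_inj ->].
- rewrite -val_eqE /= gtn_eqF // mul0n; apply/eqP/negPn/negP => /cls_le.
  by rewrite leqNgt (leq_trans _ clsj).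
- move: (eqE i); rewrite -val_eqE /= ltn_eqF // !mul0n mj // => /eqP.
  by rewrite addn0 eq_sym addn_eq0 => /andP[/eqP].
- by rewrite eqxx mul1n.
Qed.

Lemma pommaret_threshold (H : seq {mpoly k[n]}) : pommaret_basis le I H ->
  exists2 d, (d <= n)%N &
    (forall j : 'I_n, (d <= j)%N ->
       exists2 h, h \in H & exists a, lexp le h = (U_(j) *+ a)%MM) /\
    (forall m, lexp_ideal m -> exists2 i : 'I_n, (d <= i)%N & m i != 0%N).
Proof.
move=> HI.
pose Q e := exists2 m, lexp_ideal m & forall i : 'I_n, (e <= i)%N -> m i = 0%N.
have Q0 : ~ Q 0%N.
  case=> m Im m0; apply: lexp_ideal0; congr lexp_ideal: Im.
  by apply/mnmP => i; rewrite m0 // mnm0E.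
(* [d] is where the leading exponents first start to live on the first variables alone: none is
   supported on the first [d], but one is on the first [d.+1], unless [d = n]. *)
have [d le_dn [NQd Qd]] : exists2 d, (d <= n)%N & ~ Q d /\ (d = n \/ Q d.+1).
  elim: (n) => [|N [d le_dN [NQd [dN|QSd]]]].
  - by exists 0%N => //; split => //; left.
  - have [QN|NQN] := boolp.EM (Q N.+1).
      by exists N; rewrite // -dN; split=> //; right; rewrite dN.
    by exists N.+1 => //; split=> //; left.
  - by exists d; [apply: leqW | split=> //; right].
exists d => //; split=> [j le_dj|m Im].
  case: Qd => [dn|[m Im m0]]; first by rewrite dn leqNgt ltn_ord in le_dj.
  apply: pommaret_pure_power HI Im _ => i lt_ji.
  by apply: m0; apply: leq_ltn_trans lt_ji.
apply: boolp.contrapT => noi; apply: NQd; exists m => // i le_di.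
by apply/eqP/negPn/negP => nz_mi; apply: noi; exists i.
Qed.

End LeadingExponents.

(** * Homogeneous components *)

Lemma pihomog_homog_mul (k : fieldType) (n d e : nat) (p q : {mpoly k[n]}) :
    q \is e.-homog ->
  pihomog mdeg d (p * q) =
    if (e <= d)%N then pihomog mdeg (d - e) p * q else 0.
Proof.
move=> q_hom.
have [N lt_pN lt_dN] : exists2 N, (msize p <= N)%N & (d < N)%N.
  by exists (maxn (msize p) d.+1); rewrite ?leq_maxl ?leq_maxr.
rewrite {1}(pihomog_partitionE lt_pN) mulr_suml raddf_sum /=.
have pq_hom i : pihomog mdeg i p * q \is (i + e).-homog.
  by apply: dhomogM q_hom; apply: pihomogP.
case: ifP => [le_ed|/negbT]; last first.
  rewrite -ltnNge => lt_de; apply: big1 => i _.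
  rewrite (@pihomog_ne0 _ _ _ (i + e)%N d) //.
  by rewrite gtn_eqF // (leq_trans lt_de) ?leq_addl.
have ltN : (d - e < N)%N by apply: leq_ltn_trans lt_dN; apply: leq_subr.
rewrite (bigD1 (Ordinal ltN)) //= big1 ?addr0.
  by rewrite pihomog_dE // -{2}(subnK le_ed).
move=> i ne_i; rewrite (@pihomog_ne0 _ _ _ (i + e)%N d) //.
apply: contra ne_i => /eqP; rewrite -val_eqE /= => <-.
by rewrite addnK.
Qed.

(** Multiplication by a homogeneous generator shifts degrees, so a component of a combination of
    generators is again one. *)
Lemma homog_ideal_pihomog (k : fieldType) (n d : nat) (I : idealr {mpoly k[n]})
  f : homog_ideal I -> f \in I -> pihomog mdeg d f \in I.
Proof.
case=> S S_hom IS /IS[s sS ->]; rewrite big_seq raddf_sum /=.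
apply: rpred_sum => u us; have [e u_hom] := S_hom _ (sS u us).
rewrite (pihomog_homog_mul _ _ u_hom); case: ifP => _; last exact: idealr0.
apply: idealMr; apply/IS; exists [:: (1, u.2)]; last by rewrite big_seq1 mul1r.
by move=> v; rewrite inE => /eqP ->; apply: (sS u us).
Qed.

Lemma msupp_pihomog (k : fieldType) (n d : nat) (p : {mpoly k[n]}) w :
  w \in msupp (pihomog mdeg d p) -> w \in msupp p /\ mdeg w = d.
Proof.
move=> pw; split; last exact: (dhomog_mf (pihomogP mdeg d p) pw).
move: w pw; rewrite pihomogE big_seq_cond.
elim/big_ind: _ => [w|q q' IHq IHq' w|m /andP[pm _] w].
- by rewrite msupp0.
- by move/msuppD_le; rewrite mem_cat => /orP[/IHq|/IHq'].
- by move/msuppZ_le/mem_msuppXP => <-.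
Qed.

(** * Rewriting of monomials towards higher exponents of chosen variables *)

Section LexKeys.
Variables (n : nat) (L : seq 'I_n).
Implicit Types (v w m : 'X_{1..n}).

Definition lexkey w : seq nat := [seq w i | i <- L].

Lemma lexkey_le v w : (forall i, i \in L -> (v i <= w i)%N) ->
  lexlt (lexkey v) (lexkey w) || (lexkey v == lexkey w).
Proof.
rewrite /lexkey; elim: L => //= i s IH le_vw; rewrite lexlt_cons.
have := le_vw i (mem_head _ _); rewrite leq_eqVlt => /orP[/eqP e|-> //].
rewrite e ltnn eqseq_cons eqxx /=; apply: IH => j js.
by apply: le_vw; rewrite inE js orbT.
Qed.

Lemma lexkeyD v m w :
  lexlt (lexkey m) (lexkey w) -> lexlt (lexkey (v + m)) (lexkey (v + w)).
Proof.
rewrite /lexkey; elim: L => //= i s IH.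
rewrite !lexlt_cons !mnmDE ltn_add2l eqn_add2l.
by case/orP => [-> //|/andP[-> /IH ->]]; rewrite orbT.
Qed.

End LexKeys.

(** By induction [t] is a monomial without ['X_i] plus higher terms. Any term containing ['X_i],
    such as those of [r * 'X_i], is higher already in its first entry. *)
Lemma bmonoid_vars (k : fieldType) (n : nat) (L : seq 'I_n) (f : {mpoly k[n]}) :
    uniq L -> bmonoid [seq 'X_i | i <- L] f ->
  exists2 m : 'X_{1..n}, forall i, i \notin L -> m i = 0%N &
    forall w, w \in msupp (f - 'X_[m]) -> lexlt (lexkey L m) (lexkey L w).
Proof.
elim: L f => [|i L IH] f /=.
  move=> _ ->; exists 0%MM => [i _|w]; first by rewrite mnm0E.
  by rewrite mpolyX0 subrr msupp0.
move=> /andP[iL uniqL] [h [r [t [/IH[//|m m0 mt] ->]]]].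
exists (U_(i) *+ h + m)%MM => [j|w].
  rewrite inE negb_or mnmDE mulmnE mnm1E eq_sym => /andP[/negPf -> /m0 ->].
  by rewrite mul0n.
have -> : 'X_i ^+ h * (t + 'X_i * r) - 'X_[U_(i) *+ h + m] =
    (t - 'X_[m] + r * 'X_i) * 'X_[U_(i) *+ h].
  rewrite mpolyXD -mpolyXn -mulrBr [RHS]mulrC; congr (_ * _).
  by rewrite addrAC [r * _]mulrC.
rewrite (perm_mem (msuppMX _ _)) => /mapP[v vt ->].
rewrite /= lexlt_cons !mnmDE ltn_add2l eqn_add2l m0 //.
case: posnP => //= vi0; rewrite vi0 /=; apply: lexkeyD; apply: mt.
have /orP[//|] : (v \in msupp (t - 'X_[m])) || (v \in msupp (r * 'X_i)).
  by rewrite -mem_cat; apply: msuppD_le.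
rewrite (perm_mem (msuppMX _ _)) => /mapP[v' _ ev].
by move: vi0; rewrite ev mnmDE mnm1E eqxx.
Qed.

Section Rewriting.
Variables (k : fieldType) (n : nat) (le : rel 'X_{1..n}).
Variables (I : idealr {mpoly k[n]}) (L : seq 'I_n).
Hypothesis le_order : term_order le.
Implicit Types (w m : 'X_{1..n}).

(** One order for both kinds of reduction: boundary elements raise the key, while basis elements
    with a pure power leading term raise it or keep it and descend for [le]. *)
Definition rewrite_lt (w' w : 'X_{1..n}) : bool :=
  lexlt (lexkey L w) (lexkey L w') ||
  [&& lexkey L w == lexkey L w', w' != w & le w' w].

Lemma rewrite_lt_irr : irreflexive rewrite_lt.
Proof. by move=> w; rewrite /rewrite_lt /lexlt ltxx !eqxx. Qed.

Lemma rewrite_lt_trans : transitive rewrite_lt.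
Proof.
have [_ le_anti le_tr _ _] := le_order.
move=> y x z; rewrite /rewrite_lt => /orP[xy|/and3P[/eqP exy nxy lexy]].
  case/orP => [yz|/andP[/eqP -> _]]; rewrite ?xy //.
  by rewrite [lexlt _ _](lt_trans yz xy).
case/orP => [yz|/and3P[/eqP -> nyz leyz]]; first by rewrite -exy yz.
rewrite exy eqxx (le_tr _ _ _ lexy leyz) andbT /= orbC.
by rewrite (contraNneq _ nxy) // => exz; apply/eqP/le_anti; rewrite lexy exz.
Qed.

(** The leading exponent vanishes on [L], so replacing it by another term of [h] cannot lower an
    exponent in [L]; homogeneity preserves the degree. *)
Lemma rewrite_leading (h : {mpoly k[n]}) w :
    h \in I -> h != 0 -> homogeneous h ->
    (lexp le h <= w)%MM -> (forall i, i \in L -> lexp le h i = 0%N) ->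
  exists2 g, 'X_[w] - g \in I &
    forall w', w' \in msupp g -> rewrite_lt w' w /\ (mdeg w' <= mdeg w)%N.
Proof.
have [_ _ _ _ leD] := le_order.
move=> Ih nz_h [e h_hom] le_hw hL; set m := lexp le h in le_hw hL.
have hm : m \in msupp h by apply: lexp_msupp.
have nz_hm : h@_m != 0 by rewrite -mcoeff_msupp.
pose t := 'X_[m] - (h@_m)^-1 *: h.
exists (t * 'X_[w - m]).
  rewrite -{1}(submK le_hw) mpolyXD [t * _]mulrC -mulrBr subKr.
  by rewrite -[_ *: h]mul_mpolyC; do 2!apply: idealMr.
move=> w'; rewrite (perm_mem (msuppMX _ _)) => /mapP[v tv ->].
have nvm : v != m.
  apply: contraTneq tv => ->.
  by rewrite mcoeff_msupp mcoeffB mcoeffZ mcoeffX eqxx mulVf // subrr eqxx.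
have hv : v \in msupp h.
  move: tv => /msuppB_le; rewrite mem_cat.
  case/orP => [/mem_msuppXP mv|/msuppZ_le //].
  by rewrite mv eqxx in nvm.
have -> : w = (w - m + m)%MM by rewrite submK.
rewrite addmK; split; last first.
  by rewrite !mdegD (dhomog_mf h_hom hv) (dhomog_mf h_hom hm).
rewrite /rewrite_lt ![(w - m + _)%MM]addmC leD ?msupp_lexp_max // andbT.
rewrite eqm_add2r nvm andbT.
apply: lexkey_le => i iL; rewrite !mnmDE hL // leq_addl //.
Qed.

(** The component of [f] of degree [mdeg m] lies in [I], and is ['X_[m]] plus terms of the same
    degree with a higher key. *)
Lemma rewrite_boundary (f : {mpoly k[n]}) m w :
    f \in I -> homog_ideal I ->
    (forall v, v \in msupp (f - 'X_[m]) -> lexlt (lexkey L m) (lexkey L v)) ->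
    (m <= w)%MM ->
  exists2 g, 'X_[w] - g \in I &
    forall w', w' \in msupp g -> rewrite_lt w' w /\ (mdeg w' <= mdeg w)%N.
Proof.
move=> If I_hom fm le_mw; pose t := 'X_[m] - pihomog mdeg (mdeg m) f.
exists (t * 'X_[w - m]).
  rewrite -{1}(submK le_mw) mpolyXD [t * _]mulrC -mulrBr subKr.
  by apply/idealMr/homog_ideal_pihomog.
move=> w'; rewrite (perm_mem (msuppMX _ _)) => /mapP[v tv ->].
have -> : w = (w - m + m)%MM by rewrite submK.
have tE : t = pihomog mdeg (mdeg m) ('X_[m] - f).
  by rewrite raddfB /= pihomogX eqxx.
move: tv; rewrite tE => /msupp_pihomog[].
rewrite -opprB (perm_mem (msuppN _)) => /fm lt_mv dv.
rewrite addmK; split; last by rewrite !mdegD dv.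
by rewrite /rewrite_lt lexkeyD.
Qed.

End Rewriting.

(** * Krull dimension *)

Lemma rmorph_monom (R S : comNzRingType) (phi : {rmorphism R -> S}) ys u :
  phi (monom ys u) = monom [seq phi y | y <- ys] u.
Proof.
elim: ys u => [|y ys IH] [|m u] /=; rewrite ?rmorph1 //.
by rewrite rmorphM rmorphXn IH.
Qed.

Lemma bmonoid_lift (R S : comNzRingType) (phi : {rmorphism R -> S}) ys f :
    (forall y, exists x, phi x = y) -> bmonoid [seq phi y | y <- ys] f ->
  exists2 g, bmonoid ys g & phi g = f.
Proof.
move=> phi_surj; elim: ys f => [|y ys IH] f /=.
  by move=> ->; exists 1; rewrite ?rmorph1.
move=> [m [r [t [/IH[t' Tt' <-] ->]]]]; have [r' <-] := phi_surj r.
exists (y ^+ m * (t' + y * r')); first by exists m, r', t'.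
by rewrite rmorphM rmorphXn rmorphD rmorphM.
Qed.

Lemma msizeM_leS (k : fieldType) (n a b : nat) (p q : {mpoly k[n]}) :
  (msize p <= a.+1)%N -> (msize q <= b.+1)%N ->
  (msize (p * q) <= (a + b).+1)%N.
Proof.
move=> pa qb.
have [->|nz_p] := eqVneq p 0; first by rewrite mul0r msize0.
have [->|nz_q] := eqVneq q 0; first by rewrite mulr0 msize0.
rewrite msizeM //; move: (leq_add pa qb); rewrite addSn addnS.
by case: (msize p + msize q)%N.
Qed.

Lemma msize_monom (k : fieldType) (n c e : nat) (ys : seq {mpoly k[n]}) u :
    (forall y, y \in ys -> (msize y <= c.+1)%N) -> all (fun j => j < e)%N u ->
  (msize (monom ys u) <= (size ys * (c * e)).+1)%N.
Proof.
elim: ys u => [|y ys IH] [|m u] /=; rewrite ?msize1 //.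
move=> ysc /andP[lt_me ue].
rewrite mulSn; apply: msizeM_leS; last first.
  by apply: IH => // z zys; apply: ysc; rewrite inE zys orbT.
have yc : (msize y <= c.+1)%N by apply: ysc; rewrite mem_head.
have : (msize (y ^+ m) <= (c * m).+1)%N.
  elim: (m) => [|j IHj]; first by rewrite expr0 msize1.
  by rewrite exprS mulnS; apply: msizeM_leS.
by move/leq_trans; apply; rewrite ltnS leq_mul // ltnW.
Qed.

Lemma prod_box (n d e B : nat) : (d <= n)%N ->
  (\prod_(i < n) (if (i < d)%N then e else B) = e ^ d * B ^ (n - d))%N.
Proof.
move=> le_dn.
rewrite -(big_mkord xpredT (fun i => if (i < d)%N then e else B)).
rewrite (big_cat_nat (leq0n d) le_dn) /=; congr (_ * _)%N.
  rewrite -[in RHS](subn0 d) -prod_nat_const_nat.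
  by apply: eq_big_nat => i /andP[_ ->].
rewrite -prod_nat_const_nat; apply: eq_big_nat => i /andP[le_di _].
by rewrite ltnNge le_di.
Qed.

Lemma ideal_quot_eq0 (R : comNzRingType) (I : idealr R) (x : R) :
  (\pi_{ideal_quot I}%qT x == 0) = (x \in I).
Proof. by rewrite !piE Quotient.equivE subr0. Qed.

Section Dimension.
Variables (k : fieldType) (n : nat) (le : rel 'X_{1..n}).
Variables (I : idealr {mpoly k[n]}) (H : seq {mpoly k[n]}) (d : nat).
Hypothesis le_order : term_order le.
Hypothesis le_dn : (d <= n)%N.
Hypothesis H_I : forall h, h \in H -> h \in I /\ h != 0.
Hypothesis H_hom : forall h, h \in H -> homogeneous h.
Hypothesis H_pure : forall j : 'I_n, (d <= j)%N ->
  exists2 h, h \in H & exists a, lexp le h = (U_(j) *+ a)%MM.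

Definition free_vars : seq 'I_n := [seq widen_ord le_dn i | i <- enum 'I_d].

Lemma mem_free_vars i : (i \in free_vars) = (i < d)%N.
Proof.
apply/mapP/idP => [[j _ ->]|lt_id]; first exact: (ltn_ord j).
by exists (Ordinal lt_id); [rewrite mem_enum | apply: val_inj].
Qed.

Lemma free_vars_uniq : uniq free_vars.
Proof.
by rewrite map_inj_uniq ?enum_uniq // => i j [e]; apply: val_inj.
Qed.

Lemma pure_power_bound : exists B, forall j : 'I_n, (d <= j)%N ->
  exists2 h, h \in H & exists2 a, (a < B)%N & lexp le h = (U_(j) *+ a)%MM.
Proof.
have [a aP] : exists a : 'I_n -> nat, forall j : 'I_n, (d <= j)%N ->
    exists2 h, h \in H & lexp le h = (U_(j) *+ a j)%MM.
  apply: (@fin_all_exists 'I_n (fun=> nat) (fun j a => (d <= j)%N ->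
    exists2 h, h \in H & lexp le h = (U_(j) *+ a)%MM)) => j.
  have [/H_pure[h Hh [a eh]]|_] := boolP (d <= j)%N; last by exists 0%N.
  by exists a; exists h.
exists (\max_j a j).+1 => j /aP[h Hh eh]; exists h => //; exists (a j) => //.
by rewrite ltnS leq_bigmax.
Qed.

Definition spans_below (e : nat) (V : seq 'X_{1..n}) : Prop :=
  forall q : {mpoly k[n]}, (msize q <= e)%N ->
    exists2 g, q - g \in I & {subset msupp g <= V}.

Lemma rewrite_pure B (w : 'X_{1..n}) (j : 'I_n) :
    (forall j : 'I_n, (d <= j)%N -> exists2 h, h \in H &
       exists2 a, (a < B)%N & lexp le h = (U_(j) *+ a)%MM) ->
    (d <= j)%N -> (B <= w j)%N ->
  exists2 g, 'X_[w] - g \in I & forall w', w' \in msupp g ->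
    rewrite_lt le free_vars w' w /\ (mdeg w' <= mdeg w)%N.
Proof.
move=> BP le_dj le_Bw; have [h Hh [a lt_aB eh]] := BP j le_dj.
have [Ih nz_h] := H_I Hh.
apply: (rewrite_leading le_order Ih nz_h (H_hom Hh)).
  rewrite eh; apply/mnm_lepP => i; rewrite mulmnE mnm1E.
  have [<-|] := eqVneq j i; last by rewrite mul0n.
  by rewrite mul1n (leq_trans _ le_Bw) // ltnW.
move=> i; rewrite mem_free_vars eh mulmnE mnm1E => lt_id.
by rewrite -val_eqE /= gtn_eqF // (leq_trans lt_id).
Qed.

(** Exponents at least [B] beyond the first [d] variables are reducible; the first [d] exponents are
    bounded by the degree. The normal exponents thus fit in one box. *)
Lemma spans_below_finite : exists C, forall e,
  exists2 V, size V = (e ^ d * C)%N & spans_below e V.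
Proof.
have [B BP] := pure_power_bound; exists (B ^ (n - d))%N => e.
have [V szV coverV] :=
  mnm_box_cover (fun i : 'I_n => if (i < d)%N then e else B).
exists V; first by rewrite szV prod_box.
move=> q le_qe.
pose N (w : 'X_{1..n}) := [forall j : 'I_n, (d <= j)%N ==> (w j < B)%N].
have [||w|g Ig gP] := @reduce_normal _ _ I N (rewrite_lt le free_vars) q.
- exact: rewrite_lt_irr.
- exact: rewrite_lt_trans.
- rewrite negb_forall => /existsP[j]; rewrite negb_imply -leqNgt => /andP[].
  exact: rewrite_pure.
exists g => // w /gP[/forallP Nw lt_wq]; apply: coverV => i.
have := Nw i; rewrite leqNgt; case: ifP => //= lt_id _.
apply: leq_trans le_qe; apply: leq_ltn_trans lt_wq.
by rewrite mdegE (bigD1 i) //= leq_addr.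
Qed.

(** Multiples of ['X_[m]] are now reducible as well, so a normal exponent has some entry [i] below
    [m i]: one box for each [i] replaces a side [e] by the constant [m i]. The factor [e] on the
    left avoids the exponent d - 1, meaningless for d = 0. *)
Lemma spans_below_boundary f : homog_ideal I -> f \in I ->
    bmonoid [seq 'X_i | i <- free_vars] f ->
  exists C, forall e,
    exists2 V, (size V * e = e ^ d * C)%N & spans_below e V.
Proof.
move=> I_hom If /(bmonoid_vars free_vars_uniq)[m m0 fm].
have [B BP] := pure_power_bound; exists (mdeg m * B ^ (n - d))%N => e.
pose box (i j : 'I_n) := if j == i then m i else if (j < d)%N then e else B.
have [V szV coverV] := fin_all_exists2 (fun i => mnm_box_cover (box i)).
exists (flatten [seq V i | i <- enum 'I_n]).
  rewrite size_flatten /shape -map_comp sumnE big_map big_enum /=.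
  rewrite big_distrl /= mdegE mulnCA big_distrl /=.
  apply: eq_bigr => i _; rewrite szV /box (bigD1 i) //= eqxx -mulnA.
  (* For [i] beyond the free variables [m i = 0], and the box is empty. *)
  have [lt_id|le_di] := ltnP i d; last first.
    by rewrite m0 // mem_free_vars -leqNgt.
  congr (_ * _)%N; rewrite -prod_box // [RHS](bigD1 i) //= lt_id mulnC.
  by congr (_ * _)%N; apply: eq_bigr => j /negPf ->.
move=> q le_qe.
pose N (w : 'X_{1..n}) :=
  [forall j : 'I_n, (d <= j)%N ==> (w j < B)%N] && ~~ (m <= w)%MM.
have [||w|g Ig gP] := @reduce_normal _ _ I N (rewrite_lt le free_vars) q.
- exact: rewrite_lt_irr.
- exact: rewrite_lt_trans.
- rewrite negb_and negbK => /orP[|]; last first.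
    exact: (rewrite_boundary _ If I_hom fm).
  rewrite negb_forall => /existsP[j]; rewrite negb_imply -leqNgt => /andP[].
  exact: rewrite_pure.
exists g => // w /gP[/andP[/forallP Nw]].
rewrite negb_forall => /existsP[i]; rewrite -ltnNge => lt_wm lt_wq.
apply/flattenP; exists (V i); first by apply: map_f; rewrite mem_enum.
apply: coverV => j; rewrite /box; have [->//|_] := eqVneq.
have := Nw j; rewrite leqNgt; case: ifP => //= lt_jd _.
apply: leq_trans le_qe; apply: leq_ltn_trans lt_wq.
by rewrite mdegE (bigD1 j) //= leq_addr.
Qed.

(** Elements of [c i.+1] outside [c i] have linearly independent monomials modulo [c 0]; those with
    exponents below [e] number [e ^ l]. *)
Lemma prime_chain_le (c : nat -> prime_idealr {ideal_quot I}) l :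
  prime_chain c l -> (l <= d)%N.
Proof.
move=> cc; pose pi : {mpoly k[n]} -> {ideal_quot I} := \pi_{ideal_quot I}%qT.
pose piM : {rmorphism {mpoly k[n]} -> {ideal_quot I}} :=
  GRing.RMorphism.clone _ _ pi _.
have /boolp.choice[z zP] i :
    exists x, (i < l)%N -> x \in c i.+1 /\ x \notin c i.
  have [/cc[_ /boolp.existsNP[x /boolp.not_implyP[x1 /negP x0]]]|_] :=
    boolP (i < l)%N; last by exists 0.
  by exists x.
pose ys := mkseq (fun i => repr (z i)) l.
have pi_ys : [seq piM y | y <- ys] = mkseq z l.
  by rewrite -map_comp; apply: eq_map => i /=; apply: reprK.
pose D := \max_(y <- ys) msize y.
have ysD y : y \in ys -> (msize y <= D.+1)%N.
  by move=> yys; apply/leqW/(@leq_bigmax_seq _ ys xpredT (fun y => msize y)).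
have [C CP] := spans_below_finite.
(* Such a monomial has degree at most [l * D * e]; since [msize] is the degree plus one and [e] is
   positive, [(l * D).+1 * e] bounds it. *)
have bound e : (0 < e)%N -> (e ^ l <= ((l * D).+1 * e) ^ d * C)%N.
  move=> e_gt0; have [V <- Vspan] := CP ((l * D).+1 * e)%N.
  pose key (t : l.-tuple 'I_e) := [seq val j | j <- t].
  rewrite -{1}(card_ord e) -card_tuple.
  apply: (@leq_card_spanned _ _ I V _ (fun t => monom ys (key t))) => [t|b Ib].
apply: Vspan; apply: (@leq_trans (size ys * (D * e)).+1).
      apply: (msize_monom ysD); apply/allP => _ /mapP[j _ ->]; apply: ltn_ord.
    by rewrite size_mkseq mulSn mulnA -add1n leq_add2r.
  pose phi : {rmorphism k -> {ideal_quot I}} :=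
    GRing.RMorphism.clone _ _ (piM \o @mpolyC n k) _.
  apply: (@prime_chain_indep _ _ phi c (mkseq z l) _ key).
  - by rewrite size_mkseq.
  - by rewrite size_mkseq => i lt_il; rewrite nth_mkseq //; apply: zP.
  - by move=> s t /(inj_map val_inj) /val_inj.
  - by move=> t; rewrite size_map size_tuple size_mkseq.
  suff -> : \sum_t phi (b t) * monom (mkseq z l) (key t) = 0 by apply: idealr0.
  have -> : \sum_t phi (b t) * monom (mkseq z l) (key t) =
      piM (\sum_t b t *: monom ys (key t)).
    rewrite rmorph_sum -pi_ys; apply: eq_bigr => t _.
    by rewrite -rmorph_monom -mul_mpolyC rmorphM.
  by apply/eqP; rewrite ideal_quot_eq0.
rewrite leqNgt; apply/negP => lt_dl.
(* For [e = K.+1] the bound reads [e ^ l <= K * e ^ d], which fails for [d < l]. *)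
pose K := ((l * D).+1 ^ d * C)%N.
have := bound K.+1 isT; apply/negP; rewrite -ltnNge.
rewrite expnMn mulnAC -/K -(subnK lt_dl) -addSnnS expnD expnS.
rewrite ltn_pmul2r ?expn_gt0 //.
by rewrite leq_pmulr // expn_gt0.
Qed.

Hypothesis free_indep : forall m, lexp_ideal le I m ->
  exists2 i : 'I_n, (d <= i)%N & m i != 0%N.

Lemma in_subring_free_vars (f : {mpoly k[n]}) :
  f \in I -> in_subring [set i : 'I_n | (i < d)%N] f -> f = 0.
Proof.
apply: (ideal_in_subring le_order) => m /free_indep[i le_di nz_mi].
by exists i; rewrite // inE -leqNgt.
Qed.

Lemma ideal_not_bmonoid f : homog_ideal I -> f \in I ->
  ~ bmonoid [seq 'X_i | i <- free_vars] f.
Proof.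
move=> I_hom If /(spans_below_boundary I_hom If)[C CP].
(* The [e ^ d] monomials in the free variables with exponents below [e] have degree below
   [d.+1 * e]. Spanning them would give [e ^ d * (d.+1 * e) <= K * e ^ d], impossible for
   [e = K.+1]. *)
pose K := (d.+1 ^ d * C)%N; pose e := K.+1.
have [V szV Vspan] := CP (d.+1 * e)%N.
pose E (t : {ffun 'I_d -> 'I_e}) : 'X_{1..n} :=
  (\sum_i U_(widen_ord le_dn i) *+ t i)%MM.
have Ewiden t i : E t (widen_ord le_dn i) = t i.
  rewrite mnm_sumE (bigD1 i) //= mulmnE mnm1E eqxx mul1n big1 ?addn0 // => j ji.
  by rewrite mulmnE mnm1E -val_eqE /= val_eqE (negPf ji).
have Eout t (i : 'I_n) : (d <= i)%N -> E t i = 0%N.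
  move=> le_di; rewrite mnm_sumE big1 // => j _.
  by rewrite mulmnE mnm1E -val_eqE /= ltn_eqF // (leq_trans (ltn_ord j)).
have E_inj : injective E.
  by move=> s t est; apply/ffunP => i; apply/val_inj; rewrite /= -!Ewiden est.
have E_deg t : (mdeg (E t) < d.+1 * e)%N.
  rewrite mdeg_sum mulSn; apply: (@leq_ltn_trans (\sum_(i < d) e)%N).
    by apply: leq_sum => i _; rewrite mdegMn mdeg1 mul1n ltnW.
  by rewrite sum_nat_const card_ord -add1n leq_add2r.
have : (e ^ d <= size V)%N.
  have -> : (e ^ d)%N = #|{ffun 'I_d -> 'I_e}| by rewrite card_ffun !card_ord.
  apply: (@leq_card_spanned _ _ I V _ (fun t => 'X_[E t])) => [t|b Ib t].
    by apply: Vspan; rewrite msizeX.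
  have coefE s : (\sum_t b t *: 'X_[k, E t])@_(E s) = b s.
    rewrite raddf_sum /= (bigD1 s) //= mcoeffZ mcoeffX eqxx mulr1.
    rewrite big1 ?addr0 // => j js.
    by rewrite mcoeffZ mcoeffX (inj_eq E_inj) (negPf js) mulr0.
  suff e0 : \sum_t b t *: 'X_[k, E t] = 0 by rewrite -coefE e0 mcoeff0.
  apply: in_subring_free_vars Ib _ => m.
  move=> /msupp_sum_le/flattenP[_ /mapP[s _ ->]] /msuppZ_le/mem_msuppXP <- i.
  by rewrite inE -leqNgt; apply: Eout.
rewrite -(@leq_pmul2r (d.+1 * e)%N) ?muln_gt0 // szV expnMn mulnAC -/K mulnC.
rewrite leq_pmul2r ?expn_gt0 // leqNgt.
by rewrite (@leq_trans e) // leq_pmull.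
Qed.

Lemma prime_chain_free_vars : homog_ideal I ->
  exists c : nat -> prime_idealr {ideal_quot I}, prime_chain c d.
Proof.
move=> I_hom; pose pi : {mpoly k[n]} -> {ideal_quot I} := \pi_{ideal_quot I}%qT.
pose piM : {rmorphism {mpoly k[n]} -> {ideal_quot I}} :=
  GRing.RMorphism.clone _ _ pi _.
pose ys : seq {mpoly k[n]} := [seq 'X_i | i <- free_vars].
have [|x ->|c [cc _]] :=
    @prime_chain_of_bmonoid _ [seq piM y | y <- ys] (fun x => x = 0).
- by split=> // [x y -> ->|a x ->]; rewrite ?addr0 ?mulr0.
- case/bmonoid_lift => [y|f fB /eqP]; first by exists (repr y); apply: reprK.
  by rewrite ideal_quot_eq0 => /(ideal_not_bmonoid I_hom).
- by exists c; move: cc; rewrite 2!size_map /free_vars size_map size_enum_ord.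
Qed.

End Dimension.

Theorem corollary3p15 (k : fieldType) (n : nat) (I : idealr {mpoly k[n]})
  (le : rel 'X_{1..n}) (D : nat)
  (Ihomog : homog_ideal I)
  (le_order : term_order le)
  (Ipommaret : exists2 H : seq {mpoly k[n]},
     pommaret_basis le I H & forall h, h \in H -> homogeneous h)
  (dimD : krull_dim {ideal_quot I} D) :
  (D <= n)%N /\
  unique (max_strongly_independent le I) [set i : 'I_n | (i < D)%N].
Proof.
have [H HI H_hom] := Ipommaret; have [H_I _ leH _] := HI.
have [d le_dn [H_pure free_indep]] := pommaret_threshold le_order HI.
have -> : D = d.
  have [[c cc] D_max] := dimD; apply/eqP; rewrite eqn_leq.
  rewrite (prime_chain_le le_order le_dn H_I H_hom H_pure cc) /=.
  have [c' cc'] := prime_chain_free_vars le_order le_dn H_I H_hom H_pure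
    free_indep Ihomog.
  exact: D_max cc'.
split=> //.
have indep : strongly_independent le I [set i : 'I_n | (i < d)%N].
  apply/(strongly_independentP le_order) => m /free_indep[i le_di nz_mi].
  by exists i; rewrite // inE -leqNgt.
(* An index [j] of [Y] with [d <= j] would put a pure power of ['X_j] in both lt I and the subring
   of [Y]. *)
have sub_free (Y : {set 'I_n}) :
    strongly_independent le I Y -> Y \subset [set i : 'I_n | (i < d)%N].
  move/(strongly_independentP le_order) => Yindep; apply/subsetP => j Yj.
  rewrite inE ltnNge; apply/negP => /H_pure[h Hh [a eh]].
  have [Ih nz_h] := H_I h Hh.
  have [|i iY] := Yindep (U_(j) *+ a)%MM; first by exists h.
  rewrite mulmnE mnm1E; have [ji|_] := eqVneq j i; last by rewrite mul0n.
  by rewrite -ji Yj in iY.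
split=> [|Y [Yindep Ymax]].
  split=> // Y sXY /sub_free sYX.
  by apply/eqP; rewrite eqEsubset sYX.
by apply: Ymax => //; apply: sub_free.
Qed.
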